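(* Let $m\geq 2$ be an integer. There exists $\bar\varepsilon_m>0$ such that, if the micro RKC method uses a damping parameter $\varepsilon_m\in[0,\bar\varepsilon_m]$, the following holds. Let $\lambda\leq 0$, $\zeta<0$, $\alpha_m=P_m''(0)$, and let $s$, $\tau>0$, $\eta>0$ satisfy $$(1+\alpha_m)\,\tau|\zeta|\leq \tilde\beta_s s^2=\ell_s,\qquad \eta|\lambda|\leq \ell_m^{\varepsilon_m},\qquad \eta\geq\frac{2\tau(1+\alpha_m)}{\alpha_m\ell_s}.$$ Then the mROCK2 method applied with macro-step $\tau$ and micro-step $\eta$ to the scalar test equation $\dot y=\lambda y+\zeta y$ (with $f_F(y)=\lambda y$, $f_S(y)=\zeta y$) satisfies $y_{n+1}=R_{s,m}(\lambda,\zeta,\tau,\eta)\,y_n$ with $|R_{s,m}(\lambda,\zeta,\tau,\eta)|\leq 1$, i.e. the scheme is stable.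
   Context: RKC method (micro method). For damping $\varepsilon\geq 0$ and $m$ stages, let $T_j$ be the Chebyshev polynomials ($T_0=1$, $T_1(x)=x$, $T_j=2xT_{j-1}-T_{j-2}$), $\omega_0=1+\varepsilon/m^2$, $\omega_1=T_m(\omega_0)/T_m'(\omega_0)$, $b_j=1/T_j(\omega_0)$. One step of size $h$ for $\dot u=g(u)$ from $u_0$: $k_0=u_0$, $k_1=k_0+\frac{\omega_1}{\omega_0}h\,g(k_0)$, $k_j=\nu_jk_{j-1}+\kappa_jk_{j-2}+\mu_jh\,g(k_{j-1})$ for $j=2,\dots,m$, with $\mu_j=2\omega_1b_j/b_{j-1}$, $\nu_j=2\omega_0b_j/b_{j-1}$, $\kappa_j=-b_j/b_{j-2}$; the result is $k_m$. Its stability polynomial is $P_m(z)=b_mT_m(\omega_0+\omega_1z)$, which satisfies $|P_m(z)|\leq 1$ on $[-\ell_m^{\varepsilon},0]$ with $\ell_m^\varepsilon=2\omega_0/\omega_1$. Set $\Phi_m(z)=(P_m(z)-1)/z$, $\Phi_m(0)=1$. ROCK2 method (macro method): an explicit $s$-stage Runge–Kutta method whose application to $\dot y=\kappa y$ with step $\tau$ gives $y_{n+1}=R_s(\tau\kappa)y_n$ for a real polynomial $R_s$ with $|R_s(z)|\leq 1$ for all $z\in[-\ell_s,0]$, where $\ell_s=\tilde\beta_s s^2$ ($\tilde\beta_s>0$ is the ROCK2 stability constant). mROCK2 step for $\dot y=f_F(y)+f_S(y)$: define the numerical averaged force $\bar f_{\eta,2}(y)$ by (i) $u_\eta$ = one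 RKC step of size $\eta$ for $\dot u=f_F(u)+f_S(y)$, $u(0)=y$; (ii) $\bar f_{\eta,1}(y)=(u_\eta-y)/\eta$; (iii) $v_\eta$ = one RKC step of size $\eta$ for $\dot v=f_F\bigl(v-\frac{\alpha_m\eta}{2}\bar f_{\eta,1}(y)\bigr)+f_S(y)$, $v(0)=y$; (iv) $\bar f_{\eta,2}(y)=(v_\eta-y)/\eta$. Then $y_{n+1}$ is one ROCK2 step of size $\tau$ from $y_n$ for $\dot y=\bar f_{\eta,2}(y)$. $R_{s,m}(\lambda,\zeta,\tau,\eta)$ denotes the resulting amplification factor on the test equation. *)

(* Defs.v *)
From HB Require Import structures.
From mathcomp Require Import all_boot all_order all_algebra.
From mathcomp Require Import reals.
Set Implicit Arguments. Unset Strict Implicit. Unset Printing Implicit Defensive.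
Import Order.TTheory GRing.Theory Num.Theory.
Local Open Scope ring_scope.

Section Defs.
Variable R : realType.

Fixpoint cheb_pair (j : nat) : {poly R} * {poly R} :=
  match j with
  | 0%N => (1, 'X)
  | j'.+1 => let: (a, b) := cheb_pair j' in (b, 2%:R *: ('X * b) - a)
  end.
Definition cheb (j : nat) : {poly R} := (cheb_pair j).1.

Definition omega0 (eps : R) (m : nat) : R := 1 + eps / (m%:R ^+ 2).
Definition omega1 (eps : R) (m : nat) : R :=
  (cheb m).[omega0 eps m] / ((cheb m)^`()).[omega0 eps m].
Definition bcoef (eps : R) (m j : nat) : R := ((cheb j).[omega0 eps m])^-1.
Definition mu_c (eps : R) (m j : nat) : R :=
  2 * omega1 eps m * bcoef eps m j / bcoef eps m j.-1.
Definition nu_c (eps : R) (m j : nat) : R :=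
  2 * omega0 eps m * bcoef eps m j / bcoef eps m j.-1.
Definition kappa_c (eps : R) (m j : nat) : R :=
  - (bcoef eps m j / bcoef eps m j.-2).

Definition Pm (eps : R) (m : nat) : {poly R} :=
  bcoef eps m m *: (cheb m \Po ((omega0 eps m)%:P + omega1 eps m *: 'X)).
Definition alpha_m (eps : R) (m : nat) : R := ((Pm eps m)^`(2)).[0].
Definition ell_m (eps : R) (m : nat) : R := 2 * omega0 eps m / omega1 eps m.

(* RKC stages: rkc_pair j = (k_{j-1}, k_j) for j >= 1. *)
Fixpoint rkc_pair (eps : R) (m : nat) (g : R -> R) (h u0 : R) (j : nat) : R * R :=
  match j with
  | 0%N => (u0, u0)
  | j'.+1 =>
    match j' with
    | 0%N => (u0, u0 + omega1 eps m / omega0 eps m * h * g u0)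
    | _ => let: (a, b) := rkc_pair eps m g h u0 j' in
           (b, nu_c eps m j * b + kappa_c eps m j * a + mu_c eps m j * h * g b)
    end
  end.
Definition rkc_step (eps : R) (m : nat) (g : R -> R) (h u0 : R) : R :=
  (rkc_pair eps m g h u0 m).2.

Definition fbar1 (eps : R) (m : nat) (fF fS : R -> R) (eta y : R) : R :=
  (rkc_step eps m (fun u => fF u + fS y) eta y - y) / eta.
Definition fbar2 (eps : R) (m : nat) (fF fS : R -> R) (eta y : R) : R :=
  let f1 := fbar1 eps m fF fS eta y in
  (rkc_step eps m
     (fun v => fF (v - alpha_m eps m * eta / 2 * f1) + fS y) eta y - y) / eta.

(* Generic explicit s-stage Runge--Kutta method with Butcher tableau (a, bw):
   K_i = y + tau * sum_{j<i} a i j f(K_j),  y1 = y + tau * sum_{i<s} bw i f(K_i).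
   Only entries a i j with j < i are used (explicit method). *)
Fixpoint rk_stages (a : nat -> nat -> R) (f : R -> R) (tau y : R) (i : nat)
  : seq R :=
  match i with
  | 0%N => [::]
  | i'.+1 => let st := rk_stages a f tau y i' in
             rcons st (y + tau * \sum_(j < i') a i' j * f (nth 0 st j))
  end.
Definition rk_step (s : nat) (a : nat -> nat -> R) (bw : nat -> R)
  (f : R -> R) (tau y : R) : R :=
  let st := rk_stages a f tau y s in
  y + tau * \sum_(i < s) bw i * f (nth 0 st i).

(* Stability function of the RK method: y_{n+1} = R(tau kappa) y_n on y' = kappa y. *)
Definition rk_stab (s : nat) (a : nat -> nat -> R) (bw : nat -> R) (z : R) : R :=
  rk_step s a bw (fun x => z * x) 1 1.

Definition mrock2_step (s : nat) (a : nat -> nat -> R) (bw : nat -> R)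
  (eps : R) (m : nat) (fF fS : R -> R) (tau eta y : R) : R :=
  rk_step s a bw (fbar2 eps m fF fS eta) tau y.

End Defs.

(* Main.v *)
Require Import Defs.
From HB Require Import structures.
From mathcomp Require Import all_boot all_order all_algebra.
From mathcomp Require Import reals.
From mathcomp Require Import ring lra.
From mathcomp Require Import polyrcf.
Import Order.TTheory GRing.Theory Num.Theory.
Local Open Scope ring_scope.

(* On the test equation both RKC solves are affine, so with z = eta * lambda,
   x = -z, q = Phi_m(z) and alpha = alpha_m the averaged force is
   q (1 + alpha x q / 2) (lambda + zeta) y.  The step-size conditions reduce
   stability to 0 <= q and q (1 + alpha x q / 2) (1 + alpha x / 2) <= 1 + alpha.

   Every derivative of T_m is a nonnegative combination of Chebyshev
   polynomials, hence is dominated on [-omega0, omega0] by its value at omega0.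
   This gives |P_m| <= 1, i.e. 0 <= x q <= 2, and a third-order Taylor bound
   for q with P_m'''(0) as the remainder constant.  The Chebyshev equation and
   its derivatives at omega0 show that 0.24 <= alpha <= 0.35 and
   P_m'''(0) <= 0.21 alpha as soon as T_m(omega0) <= 1.05, which is what epsbar
   ensures.  Hence q <= 1 - 0.39 alpha x for x <= 3.1; the target inequality
   follows from this for x <= 3.1 and from x q <= 2 beyond. *)

(** * Chebyshev polynomials: identities, differential equations, domination by endpoint values *)

Section Chebyshev.
Variable R : realType.
Local Notation T := (cheb R).

Lemma chebSS n : T n.+2 = 2%:R *: ('X * T n.+1) - T n.
Proof. by rewrite /cheb /=; case: (cheb_pair R n) => a b. Qed.

(* [chebS n] is the second-kind polynomial U_{n-1}. *)
Fixpoint chebS (n : nat) : {poly R} :=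
  if n is n'.+1 then T n' + 'X * chebS n' else 0.

Lemma cheb_step n : T n.+1 = 'X * T n + ('X ^+ 2 - 1) * chebS n.
Proof.
elim: n => [|n IH]; first by rewrite /cheb /= mulr1 mulr0 addr0.
rewrite chebSS /= scaler_nat IH; ring.
Qed.

(** Unrolled, this writes U_{n-1} as a nonnegative combination of the T_j, which puts the
    derivatives of T_n in [cheb_cone]. *)
Lemma chebS_step n : chebS n.+2 = chebS n + 2%:R *: T n.+1.
Proof. rewrite [LHS]/= scaler_nat cheb_step /=; ring. Qed.

(** Algebraic form of cos^2 + sin^2 = 1: it yields |T_n| <= 1 on [-1, 1] without trigonometry, since
    X^2 - 1 is nonpositive there. *)
Lemma cheb_pell n : T n ^+ 2 - ('X ^+ 2 - 1) * chebS n ^+ 2 = 1.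
Proof.
elim: n => [|n IH]; first by rewrite /cheb /= expr1n expr0n mulr0 subr0.
by rewrite -[RHS]IH cheb_step /=; ring.
Qed.

Lemma deriv_X2_sub1 : ('X ^+ 2 - 1 : {poly R})^`() = 2%:R * 'X.
Proof. by rewrite derivB -[1]polyC1 derivC expr2 derivM derivX; ring. Qed.

(** The two identities are proved together because the induction step for each uses the other.
    Eliminating [chebS] gives the Chebyshev equation. *)
Lemma cheb_deriv_system n : (T n)^`() = n%:R * chebS n /\
  ('X ^+ 2 - 1) * (chebS n)^`() = n%:R * T n - 'X * chebS n.
Proof.
elim: n => [|n [IH1 IH2]].
  by rewrite /cheb /= deriv0 -polyC1 derivC !mul0r !mulr0 subr0.
split.
  rewrite cheb_step derivD !derivM deriv_X2_sub1 IH2 IH1 derivX /= -(natr1 n); ring.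
rewrite /= derivD derivM derivX IH1 -(natr1 n).
transitivity (('X ^+ 2 - 1) * (n%:R * chebS n + chebS n) +
  'X * (('X ^+ 2 - 1) * (chebS n)^`())); first by ring.
rewrite IH2 cheb_step; ring.
Qed.

Lemma cheb_ode n : ('X ^+ 2 - 1) * (T n)^`(2) + 'X * (T n)^`() = n%:R ^+ 2 * T n.
Proof.
have [H1 H2] := cheb_deriv_system n.
rewrite derivnS derivn1 H1 mulr_natl derivMn -mulr_natl.
transitivity (n%:R * (('X ^+ 2 - 1) * (chebS n)^`() + 'X * chebS n)); first by ring.
by rewrite H2; ring.
Qed.

(** Obtained by differentiating the Chebyshev equation k times. Evaluated at omega0 >= 1, where all
    terms are nonnegative, it bounds each derivative by the preceding one. *)
Lemma cheb_ode_deriv n k :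
  ('X ^+ 2 - 1) * (T n)^`(k.+2) + (k.*2.+1)%:R * 'X * (T n)^`(k.+1) =
  (n%:R ^+ 2 - k%:R ^+ 2) * (T n)^`(k).
Proof.
elim: k => [|k IH]; first by rewrite derivn0 derivn1 mul1r expr0n subr0 cheb_ode.
have dN j : (j%:R : {poly R})^`() = 0 by rewrite -polyC_natr derivC.
have := congr1 (fun p => p^`()) IH.
rewrite derivD !derivM deriv_X2_sub1 -!derivnS derivX dN derivB !expr2 !derivM !dN.
rewrite doubleS -!(natr1 k) -!(natr1 k.*2.+2) -!(natr1 k.*2.+1) -!(natr1 k.*2) -mul2n natrM => H.
apply/eqP; rewrite -subr_eq0; move/eqP: H; rewrite -subr_eq0 => /eqP <-.
apply/eqP; ring.
Qed.

Lemma cheb1 n : (T n).[1] = 1.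
Proof.
elim: n => [|n IH]; first by rewrite /cheb /= hornerC.
by rewrite cheb_step !hornerE /= IH expr1n subrr mul0r addr0.
Qed.

Lemma chebN n x : (T n).[- x] = (-1) ^+ n * (T n).[x].
Proof.
suff: (T n).[- x] = (-1) ^+ n * (T n).[x] /\ (T n.+1).[- x] = (-1) ^+ n.+1 * (T n.+1).[x] by case.
elim: n => [|n [IH1 IH2]].
  by rewrite /cheb /= !hornerE /= ?expr0 ?expr1 ?mul1r ?mulN1r.
split=> //; rewrite chebSS !hornerE /= IH1 IH2 !exprS; ring.
Qed.

Lemma cheb_le1 n x : `|x| <= 1 -> `|(T n).[x]| <= 1.
Proof.
move=> hx; have /(congr1 (horner^~ x)) := cheb_pell n.
rewrite !hornerE /= => H.
have hx2 : x ^+ 2 <= 1 by rewrite -real_normK ?num_real // expr_le1.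
rewrite -(@expr_le1 _ 2) // real_normK ?num_real //.
have := sqr_ge0 (chebS n).[x]; nra.
Qed.

(** The increments are carried along in the induction because T_{n+2} - T_{n+1} = 2 (x - 1) T_{n+1}
    + (T_{n+1} - T_n) keeps them nonnegative and increasing on [1, +oo). *)
Lemma cheb_mono n x y : 1 <= x -> x <= y ->
  [/\ 0 <= (T n).[x], (T n).[x] <= (T n).[y],
      0 <= (T n.+1).[x] - (T n).[x] &
      (T n.+1).[x] - (T n).[x] <= (T n.+1).[y] - (T n).[y]].
Proof.
move=> hx hxy; elim: n => [|n [a b c d]].
  by rewrite /cheb /= !hornerE /=; split; lra.
split; [lra|lra|..]; rewrite chebSS !hornerE /=.
  have : 0 <= (x - 1) * (T n.+1).[x] by rewrite mulr_ge0 //; lra.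
  lra.
have : 0 <= (y - x) * (T n.+1).[x] by rewrite mulr_ge0 //; lra.
have : 0 <= (y - 1) * ((T n.+1).[y] - (T n.+1).[x]) by rewrite mulr_ge0 //; lra.
lra.
Qed.

Lemma cheb_ge1 n x : 1 <= x -> 1 <= (T n).[x].
Proof. by move=> hx; have [_ + _ _] := cheb_mono n _ _ (lexx 1) hx; rewrite cheb1. Qed.

Lemma cheb_dominated n x w : 1 <= w -> `|x| <= w -> `|(T n).[x]| <= (T n).[w].
Proof.
move=> hw hx; have [x1|x1] := lerP `|x| 1.
  exact: le_trans (cheb_le1 _ _ x1) (cheb_ge1 _ _ hw).
have -> : `|(T n).[x]| = `|(T n).[`|x|]|.
  case: (ger0P x) => // _.
  by rewrite chebN normrM normrX normrN1 expr1n mul1r.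
by have [h0 h1 _ _] := cheb_mono n _ _ (ltW x1) hx; rewrite ger0_norm.
Qed.

(* Stability of this cone under derivation is what makes every derivative of
   T_n reach its maximum modulus over [-w, w], w >= 1, at the endpoint w. *)
Inductive cheb_cone : {poly R} -> Prop :=
| cheb_cone0 : cheb_cone 0
| cheb_coneD c n p : 0 <= c -> cheb_cone p -> cheb_cone (c *: T n + p).

Lemma cheb_cone_add p q : cheb_cone p -> cheb_cone q -> cheb_cone (p + q).
Proof.
move=> + hq; elim=> [|c n r hc _ IH]; first by rewrite add0r.
by rewrite -addrA; apply: cheb_coneD.
Qed.

Lemma cheb_cone_scale c p : 0 <= c -> cheb_cone p -> cheb_cone (c *: p).
Proof.
move=> hc; elim=> [|d n r hd _ IH]; first by rewrite scaler0; exact: cheb_cone0.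
by rewrite scalerDr scalerA; apply: cheb_coneD; rewrite // mulr_ge0.
Qed.

Lemma cheb_cone_cheb n : cheb_cone (T n).
Proof.
rewrite -[T n]addr0 -[T n]scale1r; apply: cheb_coneD; rewrite ?ler01 //.
exact: cheb_cone0.
Qed.

Lemma cheb_cone_S n : cheb_cone (chebS n).
Proof.
suff: cheb_cone (chebS n) /\ cheb_cone (chebS n.+1) by case.
elim: n => [|n [IH1 IH2]].
  split; first exact: cheb_cone0.
  by rewrite /= mulr0 addr0; exact: cheb_cone_cheb.
split=> //; rewrite chebS_step; apply: cheb_cone_add => //.
by apply: cheb_cone_scale; [rewrite ler0n | exact: cheb_cone_cheb].
Qed.

Lemma cheb_cone_deriv p : cheb_cone p -> cheb_cone p^`().
Proof.
elim=> [|c n r hc _ IH]; first by rewrite deriv0; exact: cheb_cone0.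
rewrite derivD derivZ; apply: cheb_cone_add => //; apply: cheb_cone_scale => //.
rewrite (cheb_deriv_system n).1 -polyC_natr mul_polyC.
by apply: cheb_cone_scale; [rewrite ler0n | exact: cheb_cone_S].
Qed.

Lemma cheb_cone_derivn n k : cheb_cone (T n)^`(k).
Proof.
elim: k => [|k IH]; first by rewrite derivn0; exact: cheb_cone_cheb.
by rewrite derivnS; exact: cheb_cone_deriv.
Qed.

Lemma cheb_cone_dominated p x w : cheb_cone p -> 1 <= w -> `|x| <= w ->
  `|p.[x]| <= p.[w].
Proof.
move=> + hw hx; elim=> [|c n r hc _ IH]; first by rewrite !horner0 normr0.
rewrite !hornerE /= (le_trans (ler_normD _ _)) // lerD // normrM ger0_norm //.
by rewrite ler_wpM2l // cheb_dominated.
Qed.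

End Chebyshev.

(** * A one-sided third-order Taylor bound *)

Section PolynomialTaylor.
Variable R : rcfType.
Implicit Types p : {poly R}.

Lemma horner_ge0_of_deriv p L : p.[0] = 0 ->
  (forall u, 0 <= u <= L -> 0 <= p^`().[u]) -> forall u, 0 <= u <= L -> 0 <= p.[u].
Proof.
move=> p0 dp u /andP[u0 uL]; have [u_gt0|] := ltP 0 u; last first.
  by move=> ?; have -> : u = 0 by [lra]; rewrite p0.
have [c] := poly_mvt p u_gt0; rewrite in_itv /= => /andP[c0 cu].
rewrite p0 !subr0 => ->; rewrite mulr_ge0 // dp //; lra.
Qed.

(** The largest third derivative sits at w itself, so it can serve as remainder constant. The
    differences satisfy q0' = q1, q1' = q2 and q2' >= 0, and all vanish at 0; nonnegativity is thus
    integrated upwards three times. *)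
Lemma taylor3_lower p w L :
  (forall x, w - L <= x <= w -> p^`(3).[x] <= p^`(3).[w]) ->
  forall u, 0 <= u <= L ->
  p.[w] - u * p^`().[w] + u ^+ 2 / 2 * p^`(2).[w] - u ^+ 3 / 6 * p^`(3).[w] <= p.[w - u].
Proof.
move=> h3 u hu.
have dc (q : {poly R}) : (q \Po (w%:P - 'X))^`() = - (q^`() \Po (w%:P - 'X)).
  by rewrite deriv_comp derivB derivC derivX sub0r mulrN1.
set d0 := p.[w]; set d1 := p^`().[w]; set d2 := p^`(2).[w]; set d3 := p^`(3).[w].
pose q2 : {poly R} := (p^`(2) \Po (w%:P - 'X)) - (d2%:P - d3 *: 'X).
pose q1 : {poly R} := (d1%:P - d2 *: 'X + (d3 / 2) *: 'X^2) - (p^`() \Po (w%:P - 'X)).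
pose q0 : {poly R} := (p \Po (w%:P - 'X)) -
  (d0%:P - d1 *: 'X + (d2 / 2) *: 'X^2 - (d3 / 6) *: 'X^3).
have H2 : forall v, 0 <= v <= L -> 0 <= q2.[v].
  apply: horner_ge0_of_deriv.
    by rewrite /q2 !hornerE horner_comp !hornerE /= /d2 ?subr0; ring.
  move=> v hv; rewrite /q2 derivB dc derivB derivC derivZ derivX -derivnS.
  rewrite !hornerE horner_comp !hornerE /=.
  have := h3 (w - v); rewrite -/d3; lra.
have H1 : forall v, 0 <= v <= L -> 0 <= q1.[v].
  apply: horner_ge0_of_deriv.
    by rewrite /q1 !hornerE horner_comp !hornerE /= /d1 ?subr0; ring.
  move=> v hv; have := H2 v hv.
  rewrite /q1 /q2 !derivE dc -[p^`()^`()]/(p^`(2)) !hornerE !horner_comp !hornerE /=; lra.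
have H0 : forall v, 0 <= v <= L -> 0 <= q0.[v].
  apply: horner_ge0_of_deriv.
    by rewrite /q0 !hornerE horner_comp !hornerE /= /d0 ?subr0; ring.
  move=> v hv; have := H1 v hv.
  rewrite /q1 /q0 !derivE dc !hornerE !horner_comp !hornerE /=; lra.
have := H0 u hu; rewrite /q0 !hornerE horner_comp !hornerE /=; lra.
Qed.

End PolynomialTaylor.

(** The threshold 3.1 lies just above 2 / 0.65: beyond it x q <= 2 and al <= 0.35 suffice, while
    below it the linear bound on q leaves a one-variable inequality in t = al x. *)
Lemma averaged_force_bound (R : realFieldType) (al x q : R) :
  24 / 100 <= al -> al <= 35 / 100 -> 0 <= x -> 0 <= q -> x * q <= 2 ->
  (x <= 31 / 10 -> q <= 1 - 39 / 100 * (al * x)) ->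
  q * (1 + al * x * q / 2) * (1 + al * x / 2) <= 1 + al.
Proof.
move=> al1 al2 x0 q0 xq2 hq; have [x3|x3] := leP x (31 / 10).
  have {}hq := hq x3; set t := al * x in hq *.
  have t0 : 0 <= t by rewrite mulr_ge0 //; lra.
  have t1 : t <= 11 / 10 by rewrite /t; nra.
  set r := 1 - 39 / 100 * t in hq.
  have r0 : 0 <= r by rewrite /r; lra.
  have qr : q * (1 + t * q / 2) <= r * (1 + t * r / 2).
    have : q * q <= r * r by apply: ler_pM.
    have : 0 <= t * (r * r - q * q) -> q * (1 + t * q / 2) <= r * (1 + t * r / 2) by lra.
    by move=> + qq; apply; rewrite mulr_ge0 // subr_ge0.
  have : q * (1 + t * q / 2) * (1 + t / 2) <= r * (1 + t * r / 2) * (1 + t / 2).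
    by rewrite ler_wpM2r //; lra.
  (* The target 1.24 comes from 1 + al >= 1.24. The left side is a quartic in t: [h2] trades t^4 for
     1.1 t^3, and [h1] and [h3] are tangent bounds at 0.73, close to the maximiser of the resulting
     cubic. *)
  have : r * (1 + t * r / 2) * (1 + t / 2) <= 124 / 100.
    have h1 : 0 <= (t + 146 / 100) * (t - 73 / 100) ^+ 2.
      by rewrite mulr_ge0 ?sqr_ge0 //; lra.
    have h2 : 0 <= t ^+ 3 * (11 / 10 - t) by rewrite mulr_ge0 ?exprn_ge0 //; lra.
    have h3 : 0 <= (t - 73 / 100) ^+ 2 by exact: sqr_ge0.
    rewrite /r; nra.
  lra.
(* Here q <= 2 / 3.1 and al x q / 2 <= 0.35, whose sum is below 1. *)
have h1 : q * (1 + al * x / 2) <= 1.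
  have : 0 <= (x - 31 / 10) * q by rewrite mulr_ge0 //; lra.
  have : 0 <= (35 / 100 - al) * (x * q) by rewrite mulr_ge0 ?mulr_ge0 //; lra.
  have : 0 <= (2 - x * q) * 1 by lra.
  lra.
have h2 : 1 + al * x * q / 2 <= 1 + al.
  have : 0 <= al * (2 - x * q) by rewrite mulr_ge0 //; lra.
  lra.
have h3 : 0 <= q * (1 + al * x / 2).
  by rewrite mulr_ge0 // addr_ge0 // divr_ge0 // mulr_ge0 //; lra.
have : (1 + al * x * q / 2) * (q * (1 + al * x / 2)) <= (1 + al) * 1.
  by apply: ler_pM => //; rewrite addr_ge0 // divr_ge0 // !mulr_ge0 //; lra.
lra.
Qed.

(** * RKC stages on affine problems and the resulting averaged force *)

Section StabilityPolynomial.
Variable R : realType.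
Variables (eps : R) (m : nat).
Hypothesis eps_ge0 : 0 <= eps.

Local Notation w := (omega0 eps m).
Local Notation T := (cheb R).
Local Notation b := (bcoef eps m).

Lemma omega0_ge1 : 1 <= w.
Proof. by rewrite /omega0 lerDl divr_ge0 // exprn_ge0 // ler0n. Qed.

Lemma cheb_omega0_gt0 j : 0 < (T j).[w].
Proof. exact: lt_le_trans ltr01 (cheb_ge1 _ _ _ omega0_ge1). Qed.

Definition stageP (j : nat) : {poly R} :=
  b j *: (T j \Po (w%:P + omega1 eps m *: 'X)).
(** The division is exact because P_j(0) = 1. As a polynomial, Phi_j needs no separate value at 0,
    so lambda = 0 is covered uniformly. *)
Definition stagePhi (j : nat) : {poly R} := (stageP j - 1) %/ 'X.

Lemma stageP_Phi j : stageP j = 1 + stagePhi j * 'X.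
Proof.
rewrite /stagePhi divpK ?subrKC //; last first.
  have -> : 'X = 'X - (0 : R)%:P by rewrite subr0.
  rewrite dvdp_XsubCl rootE !hornerE horner_comp !hornerE /=.
  by rewrite ?mulr0 ?addr0 mulVf ?subrr // gt_eqF // cheb_omega0_gt0.
Qed.

(** This is the Chebyshev recurrence at omega0 divided by T_{j+2}(omega0). It lets the constant part
    y pass unchanged through the stages. *)
Lemma nu_kappa_sum j : nu_c eps m j.+2 + kappa_c eps m j.+2 = 1.
Proof.
rewrite /nu_c /kappa_c /bcoef /=.
have h0 := cheb_omega0_gt0 j; have h1 := cheb_omega0_gt0 j.+1.
have h2 := cheb_omega0_gt0 j.+2.
move: h2; rewrite chebSS !hornerE /= => h2; field.
by rewrite !gt_eqF.
Qed.

Lemma stageP_rec j :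
  stageP j.+2 = (nu_c eps m j.+2)%:P * stageP j.+1 + (kappa_c eps m j.+2)%:P * stageP j
    + (mu_c eps m j.+2)%:P * 'X * stageP j.+1.
Proof.
have h0 := cheb_omega0_gt0 j; have h1 := cheb_omega0_gt0 j.+1.
have n1 : b j.+1 != 0 by rewrite invr_eq0 gt_eqF.
have n0 : b j != 0 by rewrite invr_eq0 gt_eqF.
rewrite /stageP /nu_c /kappa_c /mu_c /= -!mul_polyC.
rewrite chebSS rmorphB /= linearZ /= rmorphM /= comp_polyX -!mul_polyC.
set q1 := _ \Po _; set q0 := _ \Po _.
have e1 c : (c * b j.+2 / b j.+1)%:P * (b j.+1)%:P = (c * b j.+2)%:P.
  by rewrite -polyCM mulfVK.
have e0 : (- (b j.+2 / b j))%:P * (b j)%:P = - (b j.+2)%:P.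
  by rewrite -polyCM mulNr mulfVK // polyCN.
rewrite !mulrA e1 e0.
rewrite -[_ * 'X * (b j.+1)%:P]mulrA ['X * _]mulrC mulrA e1 !polyCM; ring.
Qed.

Lemma stagePhi0 : stagePhi 0 = 0.
Proof.
apply: (mulIf (negbT (polyX_eq0 R))); apply: (addrI 1).
by rewrite -stageP_Phi mul0r addr0 /stageP /bcoef /cheb /= hornerC invr1 scale1r rmorph1.
Qed.

Lemma stagePhi1 : stagePhi 1 = (omega1 eps m / w)%:P.
Proof.
apply: (mulIf (negbT (polyX_eq0 R))); apply: (addrI 1).
have w0 : w != 0 by rewrite gt_eqF // (lt_le_trans ltr01 omega0_ge1).
rewrite -stageP_Phi /stageP /bcoef /cheb /= hornerX comp_polyX scalerDr scalerA.
by rewrite -mul_polyC -polyCM mulVf // -mul_polyC [w^-1 * _]mulrC.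
Qed.

Lemma stagePhi_rec j :
  stagePhi j.+2 = (nu_c eps m j.+2)%:P * stagePhi j.+1 + (kappa_c eps m j.+2)%:P * stagePhi j
    + (mu_c eps m j.+2)%:P * (1 + stagePhi j.+1 * 'X).
Proof.
apply: (mulIf (negbT (polyX_eq0 R))); apply: (addrI 1).
rewrite -(stageP_Phi j.+2) stageP_rec !stageP_Phi.
have -> : (kappa_c eps m j.+2)%:P = 1 - (nu_c eps m j.+2)%:P.
  by rewrite -[1]polyC1 -(nu_kappa_sum j) polyCD addrAC subrr add0r.
ring.
Qed.

Lemma rkc_pairSS (g : R -> R) h y j :
  rkc_pair eps m g h y j.+2 =
  let: (u, v) := rkc_pair eps m g h y j.+1 in
  (v, nu_c eps m j.+2 * v + kappa_c eps m j.+2 * u + mu_c eps m j.+2 * h * g v).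
Proof. by []. Qed.

(** For affine g one has g(v) = g(y) + lam (v - y), so the stage increments divided by h g(y) obey
    the recurrence of [stagePhi] at h lam. *)
Lemma rkc_pair_affine lam c h y j :
  rkc_pair eps m (fun u => lam * u + c) h y j.+1 =
  (y + (stagePhi j).[h * lam] * h * (lam * y + c),
   y + (stagePhi j.+1).[h * lam] * h * (lam * y + c)).
Proof.
elim: j => [|j IH].
  by rewrite stagePhi0 stagePhi1 horner0 hornerC !mul0r addr0.
rewrite rkc_pairSS IH stagePhi_rec !hornerE /=; congr (_, _).
have -> : kappa_c eps m j.+2 = 1 - nu_c eps m j.+2 by have := nu_kappa_sum j; lra.
ring.
Qed.

Lemma rkc_step_affine lam c h y : (0 < m)%N ->
  rkc_step eps m (fun u => lam * u + c) h y =
  y + (stagePhi m).[h * lam] * h * (lam * y + c).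
Proof.
move=> m0; rewrite /rkc_step; have := rkc_pair_affine lam c h y m.-1.
by rewrite prednK // => ->.
Qed.

Definition averaged_factor (z : R) : R :=
  (stagePhi m).[z] * (1 - alpha_m eps m * z * (stagePhi m).[z] / 2).

Lemma fbar2_linear lam zeta eta : (0 < m)%N -> eta != 0 ->
  forall y, fbar2 eps m (fun x => lam * x) (fun x => zeta * x) eta y =
    averaged_factor (eta * lam) * (lam + zeta) * y.
Proof.
move=> m0 e0 y; rewrite /fbar2 /fbar1 rkc_step_affine //.
(* The shift [d] does not depend on v, so the second micro problem is again affine, with the
   constant term lowered by lam d. *)
set d := alpha_m eps m * eta / 2 * _.
have -> : rkc_step eps m (fun v => lam * (v - d) + zeta * y) eta y =
          rkc_step eps m (fun v => lam * v + (zeta * y - lam * d)) eta y.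
  have E v : lam * (v - d) + zeta * y = lam * v + (zeta * y - lam * d) by ring.
  suff H j : rkc_pair eps m (fun v => lam * (v - d) + zeta * y) eta y j =
             rkc_pair eps m (fun v => lam * v + (zeta * y - lam * d)) eta y j.
    by rewrite /rkc_step H.
  elim: j => [//|[|j] IH]; first by rewrite /= E.
  by rewrite !rkc_pairSS IH; case: (rkc_pair _ _ _ _ _ _) => u v; rewrite E.
by rewrite rkc_step_affine // /averaged_factor /d; field.
Qed.

End StabilityPolynomial.

(** * Homogeneity of explicit Runge-Kutta methods on linear problems *)

Section MacroMethod.
Variable R : realType.

Lemma size_rk_stages (a : nat -> nat -> R) f tau y i :
  size (rk_stages a f tau y i) = i.
Proof. by elim: i => [//|i IH] /=; rewrite size_rcons IH. Qed.

Lemma rk_stages_linear (a : nat -> nat -> R) k tau y i :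
  rk_stages a (fun x => k * x) tau y i =
  [seq c * y | c <- rk_stages a (fun x => tau * k * x) 1 1 i].
Proof.
elim: i => [//|i IH] /=; rewrite map_rcons -IH; congr rcons.
rewrite mul1r mulrDl mul1r mulr_sumr mulr_suml; congr (_ + _).
by apply: eq_bigr => j _; rewrite IH (nth_map 0) ?size_rk_stages //; ring.
Qed.

Lemma rk_step_linear s (a : nat -> nat -> R) bw k tau y :
  rk_step s a bw (fun x => k * x) tau y = rk_stab s a bw (tau * k) * y.
Proof.
have := rk_stages_linear a k tau y s.+1 => /=; rewrite map_rcons => /rcons_inj [H _].
rewrite /rk_stab /rk_step H mul1r mulrDl mul1r mulr_sumr mulr_suml; congr (_ + _).
by apply: eq_bigr => j _; rewrite (nth_map 0) ?size_rk_stages //; ring.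
Qed.

Lemma rk_step_ext s (a : nat -> nat -> R) bw f g tau y : f =1 g ->
  rk_step s a bw f tau y = rk_step s a bw g tau y.
Proof.
move=> fg; have E i : rk_stages a f tau y i = rk_stages a g tau y i.
  elim: i => [//|i IH] /=; rewrite IH; congr (rcons _ (_ + _ * _)).
  by apply: eq_bigr => j _; rewrite fg.
by rewrite /rk_step E; congr (_ + _ * _); apply: eq_bigr => j _; rewrite fg.
Qed.

End MacroMethod.

(** * Size of P_m and of its derivatives at 0 *)

Section StabilityBounds.
Variable R : realType.
Variables (eps : R) (m : nat).
Hypotheses (m_ge2 : (2 <= m)%N) (eps_ge0 : 0 <= eps).

Local Notation w := (omega0 eps m).
Local Notation T := (cheb R m).
Local Notation M := (m%:R ^+ 2 : R).

Lemma sqr_stages_ge4 : 4 <= M.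
Proof. by rewrite -natrX (ler_nat R 4) -[4%N]/(2 ^ 2)%N leq_exp2r. Qed.

(** The leading coefficient of the Chebyshev equation vanishes at 1. *)
Lemma cheb_deriv1 : T^`().[1] = M.
Proof.
have /(congr1 (horner^~ 1)) := cheb_ode R m.
rewrite -polyC_natr !hornerE /= cheb1; lra.
Qed.

Let hw : 1 <= w.
Proof. exact: omega0_ge1. Qed.

Let cone_mono k x y : 1 <= x -> x <= y -> T^`(k).[x] <= T^`(k).[y].
Proof.
move=> hx hxy; apply: le_trans (ler_norm _) _.
apply: cheb_cone_dominated; [exact: cheb_cone_derivn | lra | rewrite ger0_norm; lra].
Qed.

Let cone_ge0 k x : 1 <= x -> 0 <= T^`(k).[x].
Proof.
move=> hx; apply: le_trans (normr_ge0 T^`(k).[1]) _.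
by apply: cheb_cone_dominated; rewrite ?normr1 //; exact: cheb_cone_derivn.
Qed.

Lemma cheb_deriv_ge : M <= T^`().[w].
Proof. by rewrite -cheb_deriv1; apply: (cone_mono 1 _ _ _ hw). Qed.

(** Mean value theorem on [1, omega0], which lies in [1, 2]. Bounding the slope at 2 makes it
    independent of eps, so that a threshold for eps can be chosen from m alone. *)
Lemma cheb_omega0_near1 : eps <= 1 -> T.[w] <= 1 + eps * T^`().[2].
Proof.
move=> e1; have M4 := sqr_stages_ge4.
have wE : w - 1 = eps / M by rewrite /omega0 addrAC subrr add0r.
have w_le : w - 1 <= eps by rewrite wE ler_pdivrMr ?ler_peMr //; lra.
have [w1|w1] := ltP 1 w; last first.
  have -> : w = 1 by apply/le_anti; rewrite w1 hw.
  by rewrite cheb1 lerDl mulr_ge0 // (cone_ge0 1) //; lra.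
have [c] := poly_mvt T w1; rewrite in_itv /= cheb1 => /andP[c1 c2] H.
have d1 : T^`().[c] <= T^`().[2] by apply: (cone_mono 1); lra.
have d0 : 0 <= T^`().[c] by apply: (cone_ge0 1); lra.
have : T^`().[c] * (w - 1) <= T^`().[2] * eps by apply: ler_pM => //; lra.
lra.
Qed.

Lemma horner_Pm z : (Pm eps m).[z] = T.[w + omega1 eps m * z] / T.[w].
Proof. by rewrite /Pm !hornerE horner_comp !hornerE /= mulrC. Qed.

Let t_gt0 : 0 < T.[w].
Proof. exact: cheb_omega0_gt0. Qed.
Let t1_gt0 : 0 < T^`().[w].
Proof. have := cheb_deriv_ge; have := sqr_stages_ge4; lra. Qed.

Lemma omega1_gt0 : 0 < omega1 eps m.
Proof. by rewrite /omega1 divr_gt0. Qed.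

Lemma alphaE : alpha_m eps m = T^`(2).[w] * T.[w] / T^`().[w] ^+ 2.
Proof.
have dc (c : R) (q : {poly R}) : (q \Po (w%:P + c *: 'X))^`() = c *: (q^`() \Po (w%:P + c *: 'X)).
  by rewrite deriv_comp derivD derivC derivZ derivX add0r -scalerAr mulr1.
rewrite /alpha_m /Pm derivnZ derivSn derivn1 dc derivZ dc -[T^`()^`()]/(T^`(2)).
rewrite !hornerE horner_comp !hornerE /= ?mulr0 ?addr0 /bcoef /omega1.
by field; rewrite !gt_eqF.
Qed.

(** Phi_m(0) equals P_m'(0), and omega1 is chosen precisely to make this 1. *)
Lemma stagePhi_at0 : (stagePhi R eps m m).[0] = 1.
Proof.
have := congr1 (fun p => p^`().[0]) (stageP_Phi R eps m eps_ge0 m).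
rewrite /stageP derivZ deriv_comp !derivE !hornerE !horner_comp !hornerE /=.
rewrite ?mulr0 ?addr0 ?add0r => <-; rewrite /bcoef /omega1.
by field; rewrite !gt_eqF.
Qed.

(** The map z -> omega0 + omega1 z sends [-ell_m, 0] onto [-omega0, omega0], where T_m is dominated
    by T_m(omega0). *)
Lemma Pm_le1 z : - ell_m eps m <= z -> z <= 0 -> `|(Pm eps m).[z]| <= 1.
Proof.
move=> z1 z0; rewrite horner_Pm normrM normfV (gtr0_norm t_gt0) ler_pdivrMr // mul1r.
apply: cheb_dominated => //; have o1 := omega1_gt0.
have : - (2 * w) <= omega1 eps m * z.
  by rewrite [omega1 _ _ * _]mulrC -ler_pdivrMr // mulNr.
have : omega1 eps m * z <= 0 by rewrite mulr_ge0_le0 // ltW.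
by rewrite ler_norml; lra.
Qed.

(** * Bounds under small damping, from the differentiated Chebyshev equations at omega0 *)

Hypotheses (eps_small : eps <= 3 / 10) (cheb_small : T.[w] <= 105 / 100).

Let ode k : (w ^+ 2 - 1) * T^`(k.+2).[w] + (k.*2.+1)%:R * w * T^`(k.+1).[w] =
  (M - k%:R ^+ 2) * T^`(k).[w].
Proof.
have /(congr1 (horner^~ w)) := cheb_ode_deriv R m k.
by rewrite -!polyC_natr -!rmorphXn -rmorphB !hornerE.
Qed.

Let ode0 : (w ^+ 2 - 1) * T^`(2).[w] + w * T^`().[w] = M * T.[w].
Proof. by have := ode 0; rewrite derivn0 derivn1 mul1r expr0n subr0. Qed.

Let ode1 : (w ^+ 2 - 1) * T^`(3).[w] + 3 * w * T^`(2).[w] = (M - 1) * T^`().[w].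
Proof. by have := ode 1; rewrite derivn1 expr1n. Qed.

Let ode2 : (w ^+ 2 - 1) * T^`(4).[w] + 5 * w * T^`(3).[w] = (M - 4) * T^`(2).[w].
Proof. by have := ode 2; rewrite -(natrX _ 2 2). Qed.

(** Without damping alpha is (m^2 - 1) / (3 m^2), which lies in [1/4, 1/3); the constants leave room
    for damping. The upper one is 1.05 / 3, from d2 <= (M - 1) d1 / 3, t <= 1.05 and M <= d1. *)
Lemma alpha_bounds : 24 / 100 <= alpha_m eps m /\ alpha_m eps m <= 35 / 100.
Proof.
have M4 := sqr_stages_ge4; have t1M := cheb_deriv_ge.
have t1 : 1 <= T.[w] := cheb_ge1 _ _ _ hw.
have t2_0 := cone_ge0 2 _ hw; have t3_0 := cone_ge0 3 _ hw; have t4_0 := cone_ge0 4 _ hw.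
have E0 := ode0; have E1 := ode1; have E2 := ode2.
rewrite alphaE.
have wE : (w - 1) * M = eps by rewrite /omega0 addrAC subrr add0r divfK // gt_eqF //; lra.
move: t1_gt0 hw wE cheb_small E0 E1 E2 t1M t1 t2_0 t3_0 t4_0.
set x := w; set t := T.[x]; set d1 := T^`().[x]; set d2 := T^`(2).[x].
set d3 := T^`(3).[x]; set d4 := T^`(4).[x].
move=> d1_gt0 x1 wE ts E0 E1 E2 d1M t1 d2_0 d3_0 d4_0.
have x2 : 0 <= x ^+ 2 - 1 by rewrite subr_ge0 expr_ge1 //; lra.
have P2 : 0 <= (x ^+ 2 - 1) * d2 by rewrite mulr_ge0.
have P3 : 0 <= (x ^+ 2 - 1) * d3 by rewrite mulr_ge0.
have P4 : 0 <= (x ^+ 2 - 1) * d4 by rewrite mulr_ge0.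
have Q2 : 0 <= (x - 1) * d2 by rewrite mulr_ge0 //; lra.
have Q3 : 0 <= (x - 1) * d3 by rewrite mulr_ge0 //; lra.
split; last first.
  rewrite ler_pdivrMr ?exprn_gt0 //.
  have : d2 * t <= (M - 1) * d1 / 3 * (105 / 100) by apply: ler_pM => //; lra.
  have : M * d1 <= d1 * d1 by rewrite ler_wpM2r //; lra.
  lra.
rewrite ler_pdivlMr ?exprn_gt0 //.
have d3le : 5 * x * d3 <= (M - 4) * d2 by lra.
(* The third-derivative term of [ode1] is at most 0.12 x d2, because (x^2 - 1)(M - 4) <= (x + 1) eps
   and eps <= 0.3. This yields the factor 3.12 in [L1]. *)
have d3le' : 5 * ((x ^+ 2 - 1) * d3) <= 6 / 10 * x * d2.
  have S1 : (x ^+ 2 - 1) * (5 * x * d3) <= (x ^+ 2 - 1) * ((M - 4) * d2).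
    by rewrite ler_wpM2l.
  have S2 : (x ^+ 2 - 1) * (M - 4) <= 6 / 10 * x.
    have : (x ^+ 2 - 1) * (M - 4) <= (x + 1) * eps by rewrite -wE; lra.
    have : (x + 1) * eps <= (2 * x) * (3 / 10) by apply: ler_pM => //; lra.
    lra.
  have S3 : (x ^+ 2 - 1) * (M - 4) * d2 <= 6 / 10 * x * d2 by rewrite ler_wpM2r.
  have : 0 <= (x - 1) * ((x ^+ 2 - 1) * d3) by rewrite mulr_ge0 //; lra.
  lra.
have L1 : (M - 1) * d1 <= 312 / 100 * x * d2 by lra.
have L0 : x * d1 <= M * t by lra.
have M_gt0 : 0 < M := lt_le_trans (ltr0n R 4) M4.
have x_gt0 : 0 < x := lt_le_trans ltr01 x1.
have M1_ge0 : 0 <= M - 1.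
  by rewrite subr_ge0 (le_trans _ M4) // (ler_nat R 1 4).
(* Multiplying [L1] by [L0] and using M - 1 >= 0.75 M gives alpha >= 0.75 / 3.12 > 0.24. *)
have L2 : (M - 1) * d1 * (x * d1) <= 312 / 100 * x * d2 * (M * t).
  by apply: ler_pM => //; apply: mulr_ge0 => //; exact: ltW.
have L3 : 75 / 100 * M * (x * (d1 * d1)) <= (M - 1) * (x * (d1 * d1)).
  by rewrite ler_wpM2r ?mulr_ge0 ?(ltW d1_gt0) ?(ltW x_gt0) //; lra.
have L4 : (x * M) * (75 / 100 * (d1 * d1)) <= (x * M) * (312 / 100 * (d2 * t)) by lra.
rewrite (ler_pM2l (mulr_gt0 x_gt0 M_gt0)) in L4.
have := sqr_ge0 d1; lra.
Qed.

(** This is P_m'''(0) <= 0.21 alpha with denominators cleared. The constant is 1.05 / 5: [ode2]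
    gives 5 T''' <= (M - 4) T'' at omega0, and M <= T'. *)
Lemma cheb_deriv3_bound : T^`(3).[w] * T.[w] <= 21 / 100 * (T^`(2).[w] * T^`().[w]).
Proof.
have M4 := sqr_stages_ge4; have t1M := cheb_deriv_ge.
have t2_0 := cone_ge0 2 _ hw; have t3_0 := cone_ge0 3 _ hw; have t4_0 := cone_ge0 4 _ hw.
have E2 := ode2.
have P4 : 0 <= (w ^+ 2 - 1) * T^`(4).[w] by rewrite mulr_ge0 // subr_ge0 expr_ge1 // (le_trans ler01).
have Q3 : 0 <= (w - 1) * T^`(3).[w] by rewrite mulr_ge0 // subr_ge0.
have : T^`(3).[w] * T.[w] <= (M - 4) * T^`(2).[w] / 5 * (105 / 100).
  by apply: ler_pM => //; [exact: ltW | lra].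
have : M * T^`(2).[w] <= T^`().[w] * T^`(2).[w] by rewrite ler_wpM2r.
lra.
Qed.

Lemma stagePhi_bounds z : - ell_m eps m <= z -> z <= 0 ->
  [/\ 0 <= (stagePhi R eps m m).[z], - z * (stagePhi R eps m m).[z] <= 2 &
      - z <= 31 / 10 ->
      (stagePhi R eps m m).[z] <= 1 - 39 / 100 * (alpha_m eps m * - z)].
Proof.
move=> z1 z0; set q := (stagePhi R eps m m).[z].
have PE : (Pm eps m).[z] = 1 + q * z.
  have := congr1 (horner^~ z) (stageP_Phi R eps m eps_ge0 m).
  by rewrite !hornerE /=.
(* With P_m = 1 + q z, the bound P_m <= 1 gives q >= 0 and P_m >= -1 gives -z q <= 2. *)
have := Pm_le1 z z1 z0; rewrite ler_norml PE => /andP[P1 P2].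
have [zn|zn] := ltP z 0; last first.
  have zz : z = 0 by lra.
  by rewrite /q zz stagePhi_at0; split; lra.
have q0 : 0 <= q by rewrite -(nmulr_lle0 _ zn); lra.
split=> //; first by lra.
move=> z3; have o1 := omega1_gt0.
have [t0 t1] := (t_gt0, t1_gt0).
have hu : 0 <= omega1 eps m * - z <= 2 * w.
  apply/andP; split; first by rewrite mulr_ge0 //; lra.
  by rewrite [omega1 _ _ * _]mulrC -ler_pdivlMr // lerNl.
have dom : forall x, w - 2 * w <= x <= w -> T^`(3).[x] <= T^`(3).[w].
  move=> x /andP[x1 x2]; apply: le_trans (ler_norm _) _.
  by apply: cheb_cone_dominated => //; [exact: cheb_cone_derivn | rewrite ler_norml; lra].
have := taylor3_lower _ _ _ _ dom _ hu.
have -> : w - omega1 eps m * - z = w + omega1 eps m * z by ring.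
have -> : T.[w + omega1 eps m * z] = (1 + q * z) * T.[w].
  by rewrite -PE horner_Pm divfK // gt_eqF.
have al0 : 0 <= alpha_m eps m by have [] := alpha_bounds; lra.
have D3 := cheb_deriv3_bound.
set x := - z in z3 *; have zx : z = - x by rewrite opprK.
have x0 : 0 < x by rewrite oppr_gt0.
(* [c3] is P_m'''(0), the cubic coefficient after substituting u = omega1 x and dividing by
   T_m(omega0). *)
pose c3 := T^`(3).[w] * T.[w] ^+ 2 / T^`().[w] ^+ 3.
have c3le : c3 <= 21 / 100 * alpha_m eps m.
  rewrite /c3 alphaE ler_pdivrMr ?exprn_gt0 //.
  have -> : 21 / 100 * (T^`(2).[w] * T.[w] / T^`().[w] ^+ 2) * T^`().[w] ^+ 3 =
     21 / 100 * (T^`(2).[w] * T^`().[w]) * T.[w] by field; rewrite gt_eqF.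
  by rewrite expr2 mulrA ler_wpM2r // ltW.
have -> : T.[w] - omega1 eps m * x * T^`().[w] + (omega1 eps m * x) ^+ 2 / 2 * T^`(2).[w]
   - (omega1 eps m * x) ^+ 3 / 6 * T^`(3).[w] =
   (1 - x + alpha_m eps m * x ^+ 2 / 2 - c3 * x ^+ 3 / 6) * T.[w].
  by rewrite /c3 alphaE /omega1; field; rewrite !gt_eqF.
rewrite ler_pM2r // zx => H.
have {}H : q * x <= (1 - alpha_m eps m * x / 2 + c3 * x ^+ 2 / 6) * x by lra.
rewrite ler_pM2r // in H.
(* With x <= 3.1 the cubic term contributes at most 0.21 * 3.1 / 6 = 0.1085 times alpha x, and 0.5 -
   0.1085 exceeds 0.39. *)
have : c3 * x ^+ 2 <= 21 / 100 * alpha_m eps m * (31 / 10 * x).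
  apply: (@le_trans _ _ (21 / 100 * alpha_m eps m * x ^+ 2)).
    by rewrite ler_wpM2r ?sqr_ge0.
  have c0 : 0 <= 21 / 100 * alpha_m eps m by lra.
  by rewrite ler_wpM2l // expr2 ler_wpM2r // ltW.
have : 0 <= alpha_m eps m * x by rewrite mulr_ge0 // ltW.
lra.
Qed.

End StabilityBounds.

(** * Choice of the damping threshold and combination of the step-size conditions *)

Theorem theorem4p3 (R : realType) (m : nat) (hm : (2 <= m)%N) :
  exists epsbar : R, 0 < epsbar /\
  forall eps : R, 0 <= eps -> eps <= epsbar ->
  forall (lambda zeta : R), lambda <= 0 -> zeta < 0 ->
  forall (s : nat) (a : nat -> nat -> R) (bw : nat -> R) (betat : R),
    0 < betat ->
    (* the macro method: explicit s-stage RK, stable on [-ell_s, 0], ell_s = betat s^2 *)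
    (forall z : R, - (betat * (s%:R ^+ 2)) <= z -> z <= 0 ->
        `|rk_stab s a bw z| <= 1) ->
  forall tau eta : R, 0 < tau -> 0 < eta ->
    (1 + alpha_m eps m) * tau * `|zeta| <= betat * (s%:R ^+ 2) ->
    eta * `|lambda| <= ell_m eps m ->
    eta >= 2 * tau * (1 + alpha_m eps m)
             / (alpha_m eps m * (betat * (s%:R ^+ 2))) ->
    exists Rsm : R,
      (forall y : R,
         mrock2_step s a bw eps m (fun x => lambda * x) (fun x => zeta * x)
           tau eta y = Rsm * y)
      /\ `|Rsm| <= 1.
Proof.
pose d := (cheb R m)^`().[2].
have d0 : 0 <= d.
  apply: le_trans (normr_ge0 (cheb R m)^`().[2]) _.
  apply: cheb_cone_dominated; rewrite ?ger0_norm //; try lra.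
  exact: cheb_cone_derivn R m 1%N.
(* The first entry is the bound on eps used for alpha; the second forces eps d <= 0.05, hence
   T_m(omega0) <= 1.05. Adding 1 to [d] keeps the denominator positive. *)
exists (Num.min (3 / 10) (5 / 100 / (1 + d))); split.
  by rewrite lt_min; apply/andP; split; [lra | rewrite divr_gt0 //; lra].
move=> eps e0; rewrite le_min => /andP[e1 e2] lambda zeta hl hz s a bw betat hb hR tau eta ht he.
have cs : (cheb R m).[omega0 eps m] <= 105 / 100.
  have e3 : eps * (1 + d) <= 5 / 100 by rewrite -ler_pdivlMr //; lra.
  have := cheb_omega0_near1 R eps m hm e0; rewrite -/d; lra.
have [al1 al2] := alpha_bounds R eps m hm e0 e1 cs.
set al := alpha_m eps m in al1 al2 *; set K := betat * s%:R ^+ 2 in hR *.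
rewrite (ltr0_norm hz) (ler0_norm hl) => h1 h2 h3.
(* Since zeta < 0, the first step-size condition has a positive left side; this excludes s = 0 and a
   zero denominator in the condition on eta. *)
have K0 : 0 < K.
  apply: lt_le_trans h1; rewrite !mulr_gt0 //; lra.
set z := eta * lambda.
have z0 : z <= 0 by rewrite /z mulr_ge0_le0 // ltW.
have z1 : - ell_m eps m <= z by rewrite /z; lra.
have [q0 q2 q3] := stagePhi_bounds R eps m hm e0 e1 cs z z1 z0.
exists (rk_stab s a bw (tau * (averaged_factor R eps m z * (lambda + zeta)))); split.
  move=> y; rewrite -rk_step_linear /mrock2_step.
  apply: rk_step_ext => x; rewrite fbar2_linear //; last by rewrite gt_eqF.
  exact: ltnW.
rewrite /averaged_factor -/al; set q := (stagePhi R eps m m).[z] in q0 q2 q3 *.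
have zx : 0 <= - z by lra.
have B := averaged_force_bound R al (- z) q al1 al2 zx q0 q2 q3.
set Psi := q * (1 - al * z * q / 2).
have Psi0 : 0 <= Psi.
  rewrite /Psi mulr_ge0 //.
  have : 0 <= al * (- z * q) by rewrite !mulr_ge0 //; lra.
  lra.
have h3' : 2 * tau * (1 + al) <= eta * (al * K).
  by rewrite -ler_pdivrMr // mulr_gt0 //; lra.
(* The lower bound on eta converts the stiff part tau |lambda| into a multiple of x = eta |lambda|.
   Added to the condition on zeta, it gives (1 + al) tau |lambda + zeta| <= K (1 + al x / 2), and
   [B] absorbs the last factor. *)
have h4 : (1 + al) * tau * - lambda <= K * (al * - z / 2).
  have : 2 * tau * (1 + al) * - lambda <= eta * (al * K) * - lambda.
    by rewrite ler_wpM2r //; lra.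
  rewrite /z; lra.
have h5 : Psi * ((1 + al) * (tau * (- lambda - zeta))) <= Psi * (K * (1 + al * - z / 2)).
  by rewrite ler_wpM2l //; lra.
have h6 : K * (Psi * (1 + al * - z / 2)) <= K * (1 + al).
  rewrite ler_wpM2l ?(ltW K0) //; move: B; rewrite /Psi; lra.
have h7 : (1 + al) * (Psi * (tau * (- lambda - zeta))) <= (1 + al) * K by lra.
rewrite ler_pM2l in h7; last lra.
apply: hR; first by lra.
have : 0 <= Psi * (tau * (- lambda - zeta)).
  by rewrite (mulr_ge0 Psi0) // (mulr_ge0 (ltW ht)) //; lra.
lra.
Qed.
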